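(* Let $(R,\mathfrak m)$ be a regular local ring of dimension $d$. Let $x_1,\dots,x_d$ be a regular system of parameters of $R$, and let $I$ be a monomial ideal (in the $x_i$) of $R$. Then $I$ is Burch if and only if there exist a monomial $w\in I\setminus\mathfrak m I$ (in the $x_i$) and an integer $1\le i\le d$ such that $x_i\mid w$ and $w(x_j/x_i)\in I$ for all $1\le j\le d$.
   Context: An ideal $I$ of a local ring $(R,\mathfrak m)$ is a Burch ideal if $\mathfrak m I\neq\mathfrak m(I:_R\mathfrak m)$. A monomial ideal in the $x_i$ is an ideal generated by monomials in $x_1,\dots,x_d$. *)

(* Defs.v *)
From HB Require Import structures.
From mathcomp Require Import all_boot all_algebra.
From mathcomp Require Import boolp classical_sets.

Set Implicit Arguments.
Unset Strict Implicit.
Unset Printing Implicit Defensive.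

Import GRing.Theory.

Local Open Scope classical_set_scope.
Local Open Scope ring_scope.

Section Ideals.
Variable R : comNzRingType.
Implicit Types (A I J P m : set R).

(* [idealr_closed] of ring_quotient.v is not used because it only covers
   proper ideals; here the unit ideal is an ideal. *)
Definition is_ideal I : Prop :=
  [/\ I 0,
      forall a b, I a -> I b -> I (a + b) &
      forall a b, I b -> I (a * b)].

Definition ideal_gen A : set R := smallest is_ideal A.

Definition ideal_mul I J : set R := ideal_gen [set a * b | a in I & b in J].

Definition ideal_colon I J : set R := [set a | forall b, J b -> I (a * b)].

Definition is_prime_ideal P : Prop :=
  [/\ is_ideal P, ~ P 1 & forall a b, P (a * b) -> P a \/ P b].

Definition is_maximal_ideal m : Prop :=
  [/\ is_ideal m, ~ m 1 &
      forall J, is_ideal J -> m `<=` J -> ~ J 1 -> J = m].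

Definition is_local m : Prop := forall J, is_maximal_ideal J <-> J = m.

Definition is_Burch m I : Prop :=
  ideal_mul m I <> ideal_mul m (ideal_colon I m).

End Ideals.

Definition is_noetherian (R : comNzRingType) : Prop :=
  forall I : set R, is_ideal I -> exists s : seq R, I = ideal_gen [set` s].

(* A strict chain P 0 < P 1 < ... < P n of primes (n + 1 primes, length n);
   the values of P beyond n are irrelevant. *)
Definition prime_chain (R : comNzRingType) (n : nat) (P : nat -> set R) : Prop :=
  (forall i, (i <= n)%N -> is_prime_ideal (P i)) /\
  (forall i, (i < n)%N -> P i `<` P i.+1).

Definition has_krull_dim (R : comNzRingType) (d : nat) : Prop :=
  (exists P : nat -> set R, prime_chain d P) /\
  (forall n (P : nat -> set R), prime_chain n P -> (n <= d)%N).

Definition is_regular_local (R : comNzRingType) (m : set R) (d : nat) : Prop :=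
  [/\ is_noetherian R, is_local m, has_krull_dim R d &
      exists x : 'I_d -> R, m = ideal_gen (range x)].

(* To be used when d is the dimension of the local ring (R, m). *)
Definition is_regular_system_of_parameters (R : comNzRingType) (m : set R)
    (d : nat) (x : 'I_d -> R) : Prop :=
  m = ideal_gen (range x).

Section Monomials.
Variables (R : comNzRingType) (d : nat) (x : 'I_d -> R).

Definition is_monomial (w : R) : Prop :=
  exists e : 'I_d -> nat, w = \prod_(i < d) x i ^+ e i.

Definition is_monomial_ideal (I : set R) : Prop :=
  exists2 A : set R, A `<=` is_monomial & I = ideal_gen A.

End Monomials.

(* Main.v *)
(** If [w = x_i v] is as in the statement, then [v] lies in [I : m], so [w] is
    in [m (I : m)] but not in [m I].  Conversely it is enough that [I : m] be
    generated by monomials: then [m (I : m)] is generated by the products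
    [x_i v] with [v] a monomial of [I : m], and one of these is not in [m I].

    That colons of monomial ideals behave as in a polynomial ring rests on one
    fact: every subset of a regular system of parameters generates a prime
    ideal.  By Krull's principal ideal theorem, a chain of primes
    P_0 < ... < P_d = m can be modified so that x_1, ..., x_i are in P_i; then
    P_i = (x_1, ..., x_i) + x_(i+1) P_i by descending induction on i, hence
    P_i = (x_1, ..., x_i) by Nakayama's lemma. *)
Require Import Defs.
From HB Require Import structures.
From mathcomp Require Import all_boot all_algebra.
From mathcomp Require Import boolp classical_sets.
From mathcomp Require Import ring.

Set Implicit Arguments.
Unset Strict Implicit.
Unset Printing Implicit Defensive.

Import GRing.Theory.

Local Open Scope classical_set_scope.
Local Open Scope ring_scope.

(** * Ideals, prime ideals and saturation *)

Section IdealTheory.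
Variable R : comNzRingType.
Implicit Types (A B I J K L P Q : set R) (a b r s x y z : R).

Lemma ideal0 I : is_ideal I -> I 0.
Proof. by case. Qed.

Lemma idealD I a b : is_ideal I -> I a -> I b -> I (a + b).
Proof. by case=> _ h _; apply: h. Qed.

Lemma idealMl I a b : is_ideal I -> I b -> I (a * b).
Proof. by case=> _ _; apply. Qed.

Lemma idealMr I a b : is_ideal I -> I a -> I (a * b).
Proof. by rewrite mulrC; apply: idealMl. Qed.

Lemma idealN I a : is_ideal I -> I a -> I (- a).
Proof. by move=> hI; rewrite -mulN1r; apply: idealMl. Qed.

Lemma idealB I a b : is_ideal I -> I a -> I b -> I (a - b).
Proof. by move=> hI ha hb; apply: idealD => //; apply: idealN. Qed.

Lemma ideal_gen_ideal A : is_ideal (ideal_gen A).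
Proof.
split=> [M [hM _]|a b ha hb M hM|a b hb M hM]; first exact: ideal0.
  by apply: idealD; [case: hM|apply: ha|apply: hb].
by apply: idealMl; [case: hM|apply: hb].
Qed.
Hint Resolve ideal_gen_ideal : core.

Lemma sub_ideal_gen A : A `<=` ideal_gen A.
Proof. by move=> a ha M [_]; apply. Qed.

Lemma ideal_gen_min A I : is_ideal I -> A `<=` I -> ideal_gen A `<=` I.
Proof. by move=> hI hA z; apply. Qed.

Lemma ideal_gen_sub A B : A `<=` B -> ideal_gen A `<=` ideal_gen B.
Proof.
move=> hAB; apply: ideal_gen_min => // a /hAB; exact: sub_ideal_gen.
Qed.

Lemma is_idealT : is_ideal (@setT R).
Proof. by []. Qed.

(** The ideal [I + y J]; as [y] is a single element, no longer sums are needed. [J := setT] gives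
    [I + (y)]. *)
Definition ideal_add_mul I y J : set R :=
  [set z | exists u v, [/\ I u, J v & z = u + y * v]].

Lemma ideal_add_mul_ideal I y J :
  is_ideal I -> is_ideal J -> is_ideal (ideal_add_mul I y J).
Proof.
move=> hI hJ; split.
- by exists 0, 0; split; [exact: ideal0|exact: ideal0|rewrite mulr0 addr0].
- move=> _ _ [u [v [hu hv ->]]] [u' [v' [hu' hv' ->]]].
  by exists (u + u'), (v + v'); split; [exact: idealD|exact: idealD|ring].
- move=> a _ [u [v [hu hv ->]]].
  by exists (a * u), (a * v); split; [exact: idealMl|exact: idealMl|ring].
Qed.

Lemma sub_ideal_add_mul I y J : is_ideal J -> I `<=` ideal_add_mul I y J.
Proof. by move=> hJ z hz; exists z, 0; split; [|exact: ideal0|ring]. Qed.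

Lemma ideal_add_mul_r I y J v :
  is_ideal I -> J v -> ideal_add_mul I y J (y * v).
Proof. by move=> hI hv; exists 0, v; split; [exact: ideal0| |ring]. Qed.

Lemma mem_ideal_add_mul I y : is_ideal I -> ideal_add_mul I y setT y.
Proof. by move=> hI; exists 0, 1; split; [exact: ideal0| |ring]. Qed.

Lemma ideal_colon_elt_ideal I y : is_ideal I -> is_ideal [set z | I (z * y)].
Proof.
move=> hI; split=> /= [|a b ha hb|a b hb].
- by rewrite mul0r; apply: ideal0.
- by rewrite mulrDl; apply: idealD.
- by rewrite -mulrA; apply: idealMl.
Qed.

Lemma is_prime_ideal_ideal P : is_prime_ideal P -> is_ideal P.
Proof. by case. Qed.

Lemma prime_notin_mul P a b : is_prime_ideal P -> ~ P a -> ~ P b -> ~ P (a * b).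
Proof. by case=> _ _ h ha hb /h []. Qed.

Lemma prime_notin1 P : is_prime_ideal P -> ~ P 1.
Proof. by case. Qed.

Lemma prime_exp P a n : is_prime_ideal P -> P (a ^+ n) -> P a.
Proof.
case=> _ h1 h; elim: n => [|n IH]; first by rewrite expr0.
by rewrite exprS => /h [].
Qed.

(* The contraction to [R] of the extension of [I] to the localization at [Q]. *)
Definition saturation Q I : set R := [set z | exists2 s, ~ Q s & I (s * z)].

Lemma saturation_ideal Q I :
  is_prime_ideal Q -> is_ideal I -> is_ideal (saturation Q I).
Proof.
move=> hQ hI; split.
- by exists 1; [exact: prime_notin1|rewrite mulr0; exact: ideal0].
- move=> a b [s hs ha] [t ht hb]; exists (s * t); first exact: prime_notin_mul.
  have -> : s * t * (a + b) = t * (s * a) + s * (t * b) by ring.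
  by apply: idealD => //; apply: idealMl.
- move=> a b [s hs hb]; exists s => //.
  by rewrite mulrCA; apply: idealMl.
Qed.

Lemma saturationK Q I s z :
  is_prime_ideal Q -> ~ Q s -> saturation Q I (s * z) -> saturation Q I z.
Proof.
move=> hQ hs [t ht h]; exists (t * s); first exact: prime_notin_mul.
by rewrite -mulrA.
Qed.

(** * Nakayama's lemma *)

(** For an ideal [Q], the product of [Q] and the ideal generated by [gs]; the recursion lets
    generators be eliminated one at a time. *)
Fixpoint ideal_span Q (gs : seq R) : set R :=
  if gs is g :: gs' then ideal_add_mul (ideal_span Q gs') g Q else [set 0].

Lemma ideal_span_ideal Q gs : is_ideal Q -> is_ideal (ideal_span Q gs).
Proof.
move=> hQ; elim: gs => [|g gs IH] /=; last exact: ideal_add_mul_ideal.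
by split=> [|a b -> ->|a b ->]; rewrite ?addr0 ?mulr0.
Qed.

Lemma ideal_span_mul Q gs x z :
  is_ideal Q -> Q x -> ideal_gen [set` gs] z -> ideal_span Q gs (z * x).
Proof.
move=> hQ hx; apply: (ideal_gen_min (I := [set z | ideal_span Q gs (z * x)])).
  exact/ideal_colon_elt_ideal/ideal_span_ideal.
elim: gs => [|g gs IH] a //= /[!inE] /orP[/eqP->|ha].
  exact/ideal_add_mul_r/hx/ideal_span_ideal.
exact/sub_ideal_add_mul/IH.
Qed.

(* Nakayama's lemma over the localization at [Q]. *)
Lemma nakayama_span Q N gs :
  is_prime_ideal Q -> is_ideal N ->
  (forall s z, ~ Q s -> N (s * z) -> N z) ->
  (forall g, g \in gs ->
     exists s c, [/\ ~ Q s, ideal_span Q gs c & N (s * g - c)]) ->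
  forall g, g \in gs -> N g.
Proof.
move=> hQ hN satN; have hQi := is_prime_ideal_ideal hQ.
elim: gs => [//|g gs IH] H.
have [s [_ [hs [c [q [hc hq ->]]] hN1]]] := H g (mem_head _ _).
(* Modulo [N] the relation for [g] reads [(s - q) g = c] with [s - q] outside [Q], so [g] can be
   eliminated from the other relations. *)
have hsq : ~ Q (s - q).
  by move=> h; apply: hs; rewrite -(subrK q s); apply: idealD.
have hgs h : h \in gs -> N h.
  move: h; apply: IH => h hh.
  have [|t [_ [ht [c' [q' [hc' hq' ->]]] hN2]]] := H h.
    by rewrite inE hh orbT.
  exists ((s - q) * t), (q' * c + (s - q) * c'); split.
  - exact: prime_notin_mul.
  - by apply: idealD; rewrite ?mulrA; do ?apply: idealMl => //;
      apply: ideal_span_ideal.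
  - have -> : (s - q) * t * h - (q' * c + (s - q) * c') =
      (s - q) * (t * h - (c' + g * q')) + q' * (s * g - (c + g * q)) by ring.
    by apply: idealD => //; apply: idealMl.
have hcN : N c.
  elim: gs c hc {IH H hN1} hgs => [|h gs IH] c /= hc hgs.
    by rewrite hc; apply: ideal0.
  case: hc => u [v [hu hv ->]]; apply: idealD => //.
    by apply: IH => // k hk; apply: hgs; rewrite inE hk orbT.
  by apply: idealMr => //; apply: hgs; rewrite mem_head.
move=> h /[!inE] /orP[/eqP->|]; last exact: hgs.
apply: (satN (s - q)) => //.
have -> : (s - q) * g = (s * g - (c + g * q)) + c by ring.
exact: idealD.
Qed.

Hypothesis noethR : is_noetherian R.

(** The hypothesis puts [L] inside [L' + x L] near [Q]. Since [x] is in [Q], the term [x v] is in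
    [Q L], and [nakayama_span] applies with [N] the saturation of [L']. *)
Lemma nakayama Q L L' x :
  is_prime_ideal Q -> Q x -> is_ideal L -> is_ideal L' ->
  (forall z, L z -> exists s u v, [/\ ~ Q s, L' u, L v & s * z = u + x * v]) ->
  L `<=` saturation Q L'.
Proof.
move=> hQ hx hL hL' H; have [gs eL] := noethR hL.
have hQi := is_prime_ideal_ideal hQ.
have hsat := saturation_ideal hQ hL'.
rewrite {1}eL; apply: ideal_gen_min => //.
apply: (@nakayama_span Q) => // [s z|g hg]; first exact: saturationK.
have /H[s [u [v [hs hu hv e]]]] : L g by rewrite eL; apply: sub_ideal_gen.
exists s, (v * x); split=> //.
  by apply: ideal_span_mul => //; rewrite -eL.
rewrite e mulrC addrK; exists 1; first exact: prime_notin1.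
by rewrite mul1r.
Qed.

(** * Noetherian induction and Krull's principal ideal theorem *)

(** Otherwise choice builds a strictly increasing sequence of ideals; its union is finitely
    generated, hence contained in one of its terms. *)
Lemma noetherian_ind (F : set R -> Prop) :
  (forall J, is_ideal J ->
     (forall J', is_ideal J' -> J `<` J' -> F J') -> F J) ->
  forall J, is_ideal J -> F J.
Proof.
move=> step J0 hJ0; apply: contrapT => nF0.
pose T := {J : set R | is_ideal J /\ ~ F J}.
have [f hf] : {f : T -> T & forall t, sval t `<` sval (f t)}.
  apply: (@choice T T (fun t u => sval t `<` sval u)) => -[J [hJ nF]] /=.
  apply: contrapT => h; apply: nF; apply: step => // J' hJ' hlt.
  by apply: contrapT => nF'; apply: h; exists (exist _ J' (conj hJ' nF')).
pose t0 : T := exist _ J0 (conj hJ0 nF0).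
pose S n : set R := sval (iter n f t0).
have Sid n : is_ideal (S n) by rewrite /S; case: (iter n f t0) => J [].
have Slt n : S n `<` S n.+1 by apply: hf.
have Sle k n : (k <= n)%N -> S k `<=` S n.
  move=> /subnK <-; elim: (n - k)%N => // j IH.
  by apply: subset_trans IH _; case: (Slt (j + k)%N).
pose U : set R := [set z | exists n, S n z].
have hU : is_ideal U.
  split=> [|a b [k ha] [n hb]|a b [n hb]]; first by exists 0%N; apply: ideal0.
    exists (maxn k n); apply: idealD => //.
      by apply: Sle ha; apply: leq_maxl.
    by apply: Sle hb; apply: leq_maxr.
  by exists n; apply: idealMl.
have [gs eU] := noethR hU.
have [n hn] : exists n, forall g, g \in gs -> S n g.
  have : forall g, g \in gs -> U g.
    by move=> g hg; rewrite eU; apply: sub_ideal_gen.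
  elim: (gs) => [|g hs IH] H; first by exists 0%N.
  have [n hn] := IH (fun h hh => H h (mem_behead (s := g :: hs) hh)).
  have [k hk] := H g (mem_head _ _).
  exists (maxn k n) => h /[!inE] /orP[/eqP->|/hn hS].
    by apply: Sle hk; apply: leq_maxl.
  by apply: Sle hS; apply: leq_maxr.
case: (Slt n) => _ []; apply: subset_trans (_ : U `<=` _).
  by move=> z; exists n.+1.
by rewrite eU; apply: ideal_gen_min.
Qed.

(* An ideal [J] that is not prime has [a], [b] outside it with [a b] in it, and
   a chain over [J] is controlled by its images in R/(J + a) and by its colons
   by [a], which contain [b]. *)
Lemma descending_stationary Q J0 :
  is_prime_ideal Q ->
  (forall P, is_prime_ideal P -> J0 `<=` P -> P `<=` Q -> P = Q) ->
  forall J, is_ideal J -> J0 `<=` J ->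
  forall L : nat -> set R, (forall n, is_ideal (L n)) ->
  (forall n, L n.+1 `<=` L n) -> (forall n, J `<=` L n) ->
  exists N, forall n, (N <= n)%N -> L n `<=` saturation Q (L n.+1).
Proof.
move=> hQ minQ; apply: noetherian_ind => J hJ IH hJ0 L hL Ldec hJL.
have [JQ|/existsNP[s /not_implyP[sJ sQ]]] := pselect (J `<=` Q); last first.
  exists 0%N => n _ z _; exists s => //; apply: idealMr => //; exact: hJL.
have Lle k n : (k <= n)%N -> L n `<=` L k.
  move=> /subnK <-; elim: (n - k)%N => // j h.
  exact: subset_trans (Ldec _) h.
have [pJ|npJ] := pselect (is_prime_ideal J).
  (* Now every [L n] contains [Q]: either some term equals [Q], and the chain is constant from there
     on, or all terms have elements outside [Q] and saturate to the whole ring. *)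
  have eJ := minQ _ pJ hJ0 JQ.
  have [[N hN]|h] := pselect (exists N, L N `<=` Q).
    exists N => n hn z hz; exists 1; first exact: prime_notin1.
    by rewrite mul1r; apply: hJL; rewrite eJ; apply/hN/(Lle _ _ hn).
  exists 0%N => n _ z _.
  have /existsNP[s /not_implyP[sL sQ]] : ~ (L n.+1 `<=` Q).
    by move=> h'; apply: h; exists n.+1.
  by exists s => //; apply: idealMr.
have [a [b [ha hb hab]]] : exists a b, [/\ ~ J a, ~ J b & J (a * b)].
  apply: contrapT => h; apply: npJ; split=> //.
    by move=> /JQ; apply: prime_notin1.
  move=> a b hab; apply: contrapT => /not_orP[ha hb].
  by apply: h; exists a, b.
pose L1 n := ideal_add_mul (L n) a setT.
pose L2 n := [set z | L n (z * a)].
have [||||||N1 hN1] := IH (ideal_add_mul J a setT) _ _ _ L1.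
- exact: ideal_add_mul_ideal.
- split; first exact: sub_ideal_add_mul.
  by move=> h; apply: ha; apply/h/mem_ideal_add_mul.
- by apply: subset_trans hJ0 _; apply: sub_ideal_add_mul.
- by move=> n; apply: ideal_add_mul_ideal.
- by move=> n _ [u [v [hu hv ->]]]; exists u, v; split=> //; apply: Ldec.
- by move=> n _ [u [v [hu hv ->]]]; exists u, v; split=> //; apply: hJL.
have [||||||N2 hN2] := IH [set z | J (z * a)] _ _ _ L2.
- exact: ideal_colon_elt_ideal.
- split; first by move=> z hz; apply: idealMr.
  by move=> h; apply: hb; apply: h; rewrite /= mulrC.
- by move=> z /hJ0 hz; apply: idealMr.
- by move=> n; apply: ideal_colon_elt_ideal.
- by move=> n z; apply: Ldec.
- by move=> n z; apply: hJL.
exists (maxn N1 N2) => n; rewrite geq_max => /andP[hn1 hn2] z hz.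
have [s hs [u [r [hu _ e]]]] := hN1 n hn1 z (sub_ideal_add_mul a is_idealT hz).
(* As [s z = u + a r] with [u] in [L n.+1], the product [a r] is in [L n]; the chain of colons then
   puts [t r a] in [L n.+1]. *)
have /(hN2 n hn2)[t ht htr] : L2 n r.
  have -> : (L2 n r) = L n (s * z - u) by rewrite e /L2 /=; congr (L n _); ring.
  by apply: idealB => //; [apply: idealMl|apply: Ldec].
exists (t * s); first exact: prime_notin_mul.
rewrite -mulrA e mulrDr; apply: idealD => //; first exact: idealMl.
by move: htr; rewrite /L2 /= -mulrA [r * a]mulrC.
Qed.

(* A form of Krull's principal ideal theorem.  For [y] in [P'] but not in [P],
   the ideals [M n = ((y^n) + P : x^oo)] play the role of the symbolic powers:
   if [Q] were minimal over [P + (x)], then [M N = M N.+1 + x M N] near [Q]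
   for some [N], so [y^N] would be in [(y^N.+1) + P] up to a factor outside
   [P']. *)
Lemma prime_between P P' Q x :
  is_prime_ideal P -> is_prime_ideal P' -> is_prime_ideal Q ->
  P `<` P' -> P' `<` Q -> Q x ->
  exists P'', [/\ is_prime_ideal P'', P `<` P'', P'' `<` Q & P'' x].
Proof.
move=> hP hP' hQ ltP ltQ xQ; apply: contrapT => noP.
have xP' : ~ P' x by move=> h; apply: noP; exists P'.
have hPi := is_prime_ideal_ideal hP.
pose J0 := ideal_add_mul P x setT.
have J0x : J0 x by exact: mem_ideal_add_mul.
(* Such a [P1] contains [x], which is not in [P'], so [P1] is strictly larger than [P]; were it not
   [Q], it would be the excluded [P'']. *)
have minQ P1 : is_prime_ideal P1 -> J0 `<=` P1 -> P1 `<=` Q -> P1 = Q.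
  move=> hP1 h1 h2; apply: contrapT => ne; apply: noP; exists P1; split=> //.
  - split; first by apply: subset_trans h1; apply: sub_ideal_add_mul.
    by move=> h; apply: xP'; case: ltP => h' _; apply/h'/h/h1.
  - by split=> // h; apply: ne; rewrite eqEsubset.
  - exact: h1.
have [sPP' /existsNP[y /not_implyP[yP' yP]]] := ltP.
pose M n : set R := [set z | exists k r, P (x ^+ k * z - r * y ^+ n)].
have hM n : is_ideal (M n).
  split.
  - by exists 0%N, 0; rewrite mulr0 mul0r subrr; apply: ideal0.
  - move=> a b [k [r h]] [l [t h']].
    exists (k + l)%N, (x ^+ l * r + x ^+ k * t).
    have -> : x ^+ (k + l) * (a + b) - (x ^+ l * r + x ^+ k * t) * y ^+ n =
      x ^+ l * (x ^+ k * a - r * y ^+ n) + x ^+ k * (x ^+ l * b - t * y ^+ n).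
      by rewrite exprD; ring.
    by apply: idealD => //; apply: idealMl.
  - move=> a b [k [r h]]; exists k, (a * r).
    have -> : x ^+ k * (a * b) - a * r * y ^+ n = a * (x ^+ k * b - r * y ^+ n).
      by ring.
    exact: idealMl.
have Mdec n : M n.+1 `<=` M n.
  move=> z [k [r h]]; exists k, (r * y).
  by rewrite -mulrA -exprS.
have PM n : P `<=` M n.
  by move=> z hz; exists 0%N, 0; rewrite expr0 mul1r mul0r subr0.
have [|||||N hN] := descending_stationary hQ minQ _ _
   (L := fun n => ideal_add_mul (M n) x setT) (J := J0).
- exact: ideal_add_mul_ideal.
- by [].
- by move=> n; apply: ideal_add_mul_ideal.
- by move=> n _ [u [v [hu hv ->]]]; exists u, v; split=> //; apply: Mdec.
- by move=> n _ [u [v [hu hv ->]]]; exists u, v; split=> //; apply: PM.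
have /(_ (y ^+ N))[] : M N `<=` saturation Q (M N.+1).
- apply: (@nakayama Q _ _ x) => // z hz.
  have [s hs [u [v [hu _ e]]]] :=
    hN N (leqnn _) z (sub_ideal_add_mul x is_idealT hz).
  exists s, u, v; split=> //.
  (* Membership in [M N] is insensitive to factors [x], so [x v] in [M N] gives [v] in [M N]. *)
  have [k [r h]] : M N (x * v).
    have -> : x * v = s * z - u by rewrite e; ring.
    by apply: idealB => //; [apply: idealMl|apply: Mdec].
  by exists k.+1, r; rewrite exprSr -mulrA.
- by exists 0%N, 1; rewrite expr0 subrr; apply: ideal0.
move=> s sQ [k [r h]].
(* Cancelling [y ^+ N] modulo [P] puts [x ^+ k * s] in [P'], although neither [x] nor [s] is in
   [P']. *)
have {h} : P (y ^+ N * (x ^+ k * s - r * y)).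
  have -> // : y ^+ N * (x ^+ k * s - r * y) =
               x ^+ k * (s * y ^+ N) - r * y ^+ N.+1.
  by rewrite exprS; ring.
have hP'i := is_prime_ideal_ideal hP'.
case: (hP) => _ _ /[apply] -[/(prime_exp hP)//|/sPP' h].
have : P' (x ^+ k * s).
  by rewrite -[x ^+ k * s](subrK (r * y)); apply: idealD => //; apply: idealMl.
case: (hP') => _ _ /[apply] -[/(prime_exp hP')//|].
by case: ltQ => h' _ /h'.
Qed.

(* [y] is pushed down the chain one step at a time by [prime_between]. *)
Lemma prime_chain_through n (P : nat -> set R) (y : R) k :
  prime_chain n P -> P n y -> (k < n)%N ->
  exists P' : nat -> set R, [/\ prime_chain n P', P' n = P n,
    forall i, (i <= k)%N -> P' i = P i & P' k.+1 y].
Proof.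
move=> hP hy hk.
(* Here [j] counts the steps down from the top; [j = n - k.+1] gives the claim. *)
suff : forall j, (j + k < n)%N -> exists P' : nat -> set R,
    [/\ prime_chain n P', P' n = P n,
        forall i, (i <= k)%N -> P' i = P i & P' (n - j)%N y].
  move=> /(_ (n - k.+1)%N); rewrite subKn //; apply.
  by rewrite -addnS subnK.
elim=> [|j IH] hj; first by exists P; rewrite subn0; split.
have [|P' [[hP1 hP2] eP hle hy']] := IH; first exact: leq_trans hj.
have [l el] : exists l, (n - j)%N = l.+2.
  exists (n - j - 2)%N.
  have : (2 <= n - j)%N.
    rewrite ltn_subRL addn1; apply: leq_ltn_trans hj.
    by rewrite addSn ltnS leq_addr.
  by case: (n - j)%N => [|[|m]] // _; rewrite subn2.
have hln : (l.+2 <= n)%N by rewrite -el leq_subr.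
have hkl : (k <= l)%N.
  by rewrite -ltnS -ltnS -el ltn_subRL addnS -addSn.
rewrite el in hy'.
have [||||||Q [hQ lt1 lt2 hQy]] := @prime_between (P' l) (P' l.+1) (P' l.+2) y.
- by apply: hP1; apply: ltnW; apply: ltnW.
- by apply: hP1; apply: ltnW.
- exact: hP1.
- by apply: hP2; apply: ltnW.
- exact: hP2.
- by [].
exists (fun i => if i == l.+1 then Q else P' i); split.
- split=> i hi; first by case: eqP => // _; apply: hP1.
  rewrite eqSS; case: (eqVneq i l.+1) => [->|h1].
    by rewrite eqn_leq ltnn.
  by case: (eqVneq i l) => [->|_] //; apply: hP2.
- by case: eqP => [e|//]; move: hln; rewrite e ltnn.
- move=> i hi; case: eqP => [e|_]; last exact: hle.
  by move: hkl; rewrite leqNgt -ltnS -e ltnS hi.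
- by rewrite subnS el eqxx.
Qed.

(** * Chains of primes and regular parameters in a local ring *)

Section Local.
Variable m : set R.
Hypothesis locR : is_local m.

Lemma local_maximal : is_maximal_ideal m.
Proof. exact/locR. Qed.

(** Noetherian induction replaces Zorn's lemma: a proper ideal that is not maximal lies in a
    strictly larger proper one. *)
Lemma sub_local J : is_ideal J -> ~ J 1 -> J `<=` m.
Proof.
move: J; apply: noetherian_ind => J hJ IH J1.
have [mJ|nmJ] := pselect (is_maximal_ideal J).
  by move/locR: mJ => ->.
have [J' [hJ' lt J'1]] : exists J', [/\ is_ideal J', J `<` J' & ~ J' 1].
  apply: contrapT => h; apply: nmJ; split=> // J' hJ' sJ J'1.
  apply: contrapT => ne; apply: h; exists J'; split=> //.
  by split=> // h; apply: ne; rewrite eqEsubset.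
by case: (lt) => s _; apply: subset_trans s _; apply: IH.
Qed.

Lemma local_unit s : ~ m s -> exists r, r * s = 1.
Proof.
move=> hs; apply: contrapT => h; apply: hs.
apply: (@sub_local [set z | exists r, r * s = z]).
- split=> [|_ _ [a <-] [b <-]|a _ [b <-]].
  + by exists 0; rewrite mul0r.
  + by exists (a + b); ring.
  + by exists (a * b); ring.
- by [].
- by exists 1; rewrite mul1r.
Qed.

Lemma local_prime : is_prime_ideal m.
Proof.
have [hm m1 _] := local_maximal; split=> // a b hab.
apply: contrapT => /not_orP[/local_unit[r er] hb]; apply: hb.
have -> : b = r * (a * b) by rewrite mulrA er mul1r.
exact: idealMl.
Qed.

Lemma saturation_local I : is_ideal I -> saturation m I `<=` I.
Proof.
move=> hI z [s /local_unit[r er] h].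
by rewrite -[z]mul1r -er -mulrA; apply: idealMl.
Qed.

(** The parameters are handled in order: pushing the next one down the chain keeps the lower terms,
    and with them the memberships already obtained. *)
Lemma prime_chain_parameters (s : seq R) d (P : nat -> set R) :
  prime_chain d P -> (forall y, y \in s -> m y) -> (size s <= d)%N ->
  exists P' : nat -> set R, [/\ prime_chain d P', P' d = m &
    forall i, (i < size s)%N -> P' i.+1 (nth 0 s i)].
Proof.
move=> [hP1 hP2]; elim/last_ind: s => [|s y IH] hs sd.
  (* The top prime is replaced by [m], which contains it, so the chain stays strict. *)
  exists (fun i => if i == d then m else P i); split=> //; last by rewrite eqxx.
  have hPd : P d `<=` m.
    by have [|h1 h2 _] := hP1 d; [exact: leqnn|exact: sub_local].
  split=> i hi.
    by case: eqP => _; [exact: local_prime|exact: hP1].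
  rewrite (ltn_eqF hi); case: eqP => [e|_]; last exact: hP2.
  have [h1 h2] := hP2 _ hi; rewrite e in h1 h2.
  split; first exact: subset_trans h1 hPd.
  by move=> h; apply: h2; apply: subset_trans hPd h.
rewrite size_rcons in sd *.
have [z hz||P' [hP' eP' hi]] := IH.
- by apply: hs; rewrite mem_rcons inE hz orbT.
- exact: ltnW.
have yd : P' d y by rewrite eP'; apply: hs; rewrite mem_rcons mem_head.
have [P'' [h1 h2 h3 h4]] := prime_chain_through hP' yd sd.
exists P''; split=> //; first by rewrite h2.
move=> i; rewrite ltnS leq_eqVlt nth_rcons => /predU1P[->|lt].
  by rewrite ltnn eqxx.
by rewrite lt h3 //; apply: hi.
Qed.

Lemma ideal_gen_rcons (s : seq R) y :
  ideal_gen [set` rcons s y] = ideal_add_mul (ideal_gen [set` s]) y setT.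
Proof.
rewrite eqEsubset; split.
  apply: ideal_gen_min; first exact: ideal_add_mul_ideal.
  move=> z; rewrite /= mem_rcons inE => /orP[/eqP->|hz].
    exact: mem_ideal_add_mul.
  by apply: sub_ideal_add_mul => //; apply: sub_ideal_gen.
move=> _ [u [v [hu _ ->]]]; apply: (idealD (ideal_gen_ideal _)).
  by move: hu; apply: ideal_gen_sub => z /= hz; rewrite mem_rcons inE hz orbT.
apply: (idealMr _ (ideal_gen_ideal _)); apply: sub_ideal_gen.
by rewrite /= mem_rcons mem_head.
Qed.

Lemma prime_chain_gen (s : seq R) (P : nat -> set R) :
  prime_chain (size s) P -> P (size s) = m -> m = ideal_gen [set` s] ->
  (forall i, (i < size s)%N -> P i.+1 (nth 0 s i)) ->
  forall i, (i <= size s)%N -> P i = ideal_gen [set` take i s].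
Proof.
move=> [hP1 hP2] Pm em hy.
have Ple k n : (n <= size s)%N -> (k <= n)%N -> P k `<=` P n.
  move=> hn /subnK e; rewrite -e in hn *; elim: (n - k)%N hn => [|j h] hn //.
  have h1 := h (ltnW hn); have [h2 _] := hP2 _ hn.
  exact: subset_trans h1 h2.
have gensub i : (i <= size s)%N -> ideal_gen [set` take i s] `<=` P i.
  move=> hi; apply: ideal_gen_min; first by case: (hP1 i hi).
  move=> z /= /(nthP 0)[j]; rewrite size_take_min => hj <-.
  have /andP[ji js] : (j < i)%N && (j < size s)%N by rewrite -ltn_min.
  by rewrite nth_take //; apply: Ple (hy j js).
suff H j : (j <= size s)%N ->
    P (size s - j)%N = ideal_gen [set` take (size s - j) s].
  by move=> i hi; rewrite -(subKn hi); apply: H; apply: leq_subr.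
elim: j => [|j IH] hj; first by rewrite subn0 take_size Pm.
set i := (size s - j.+1)%N; have hi : (i < size s)%N.
  by rewrite /i -subSn // subSS leq_subr.
have ei : (size s - j)%N = i.+1 by rewrite /i subnSK.
have {}IH := IH (ltnW hj); rewrite ei (take_nth 0) // ideal_gen_rcons in IH.
have [hPi _ prPi] := hP1 i (ltnW hi).
have [lei nlei] := hP2 i hi.
rewrite eqEsubset; split; last exact/gensub/ltnW.
apply: subset_trans (saturation_local (ideal_gen_ideal _)).
apply: (@nakayama m _ _ (nth 0 s i)) => //.
- exact: local_prime.
- by rewrite -Pm; apply: Ple (hy i hi).
(* With [y] the next parameter, [z = u + y v] and [y v] is in [P i]. If [y] were in [P i], then
   [P i.+1] would be inside [P i]; hence [v] is in [P i]. *)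
move=> z hz; have := lei z hz; rewrite IH => -[u [v [hu _ e]]].
exists 1, u, v; split=> //; [exact/prime_notin1/local_prime| |by rewrite mul1r].
have : P i (nth 0 s i * v).
  have -> : nth 0 s i * v = z - u by rewrite e; ring.
  by apply: idealB => //; apply: gensub hu; apply: ltnW.
move=> /prPi[h|//]; case: nlei; rewrite IH.
move=> _ [u' [v' [hu' _ ->]]]; apply: idealD => //.
  by apply: gensub hu'; apply: ltnW.
exact: idealMr.
Qed.

(** The initial segments of the list generate a strict chain of primes, so the ideal of [s1] is
    prime and does not contain [y]. *)
Lemma regular_parameter (d : nat) (s1 s2 : seq R) (y r : R) :
  has_krull_dim R d -> m = ideal_gen [set` s1 ++ y :: s2] ->
  size (s1 ++ y :: s2) = d ->
  ideal_gen [set` s1] (r * y) -> ideal_gen [set` s1] r.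
Proof.
set s := s1 ++ y :: s2 => -[[P0 hP0] _] em ed.
have [||P [hP Pm hy]] := prime_chain_parameters (s := s) hP0.
- by move=> z hz; rewrite em; apply: sub_ideal_gen.
- by rewrite ed.
rewrite -ed in hP Pm.
have H := prime_chain_gen hP Pm em hy.
have lt1 : (size s1 < size s)%N by rewrite /s size_cat /= addnS ltnS leq_addr.
have := H _ (ltnW lt1); rewrite take_size_cat // => e1.
have := H _ lt1; rewrite (take_nth 0) // take_size_cat // ideal_gen_rcons.
rewrite nth_cat ltnn subnn /= => e2.
case: hP => /(_ _ (ltnW lt1)) [_ _] + /(_ _ lt1) [_]; rewrite -{}e1 in e2 *.
move=> hpr nle /hpr[//|hy1]; case: nle; rewrite e2.
have hPi : is_ideal (P (size s1)).
  by rewrite H ?(ltnW lt1).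
move=> _ [u [v [hu _ ->]]]; apply: idealD => //; exact: idealMr.
Qed.

End Local.
End IdealTheory.

(** * Monomials and their exponents *)

Section MonomialIdeals.
Variables (R : comNzRingType) (d : nat) (x : 'I_d -> R).
Notation expo := {ffun 'I_d -> nat}.
Implicit Types (a b e f : expo) (L : seq expo) (U V : set expo) (k j : 'I_d).

Definition monom e : R := \prod_(i < d) x i ^+ e i.
Definition mon_ideal U : set R := ideal_gen (monom @` U).
Definition expo1 k : expo := [ffun i => (i == k) : nat].
Definition expoD e f : expo := [ffun i => (e i + f i)%N].
(** Truncated subtraction matches the colon by [x k]: a monomial without [x k] is left unchanged. *)
Definition expo_dec k e : expo := [ffun i => (e i - (i == k))%N].
Definition expo_deg e : nat := \sum_(i < d) e i.
Definition expo_above L : set expo :=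
  [set f | exists2 a, a \in L & forall i, (a i <= f i)%N].
Definition expo_upset U := forall e f, U e -> (forall i, (e i <= f i)%N) -> U f.

Lemma mon_ideal_ideal U : is_ideal (mon_ideal U).
Proof. exact: ideal_gen_ideal. Qed.
Hint Resolve mon_ideal_ideal : core.

Lemma mem_mon_ideal U e : U e -> mon_ideal U (monom e).
Proof. by move=> h; apply: sub_ideal_gen; exists e. Qed.

Lemma mon_ideal_min U I :
  is_ideal I -> (forall e, U e -> I (monom e)) -> mon_ideal U `<=` I.
Proof. by move=> hI h; apply: ideal_gen_min => // _ [e he <-]; apply: h. Qed.

Lemma mon_ideal_sub U V : U `<=` V -> mon_ideal U `<=` mon_ideal V.
Proof.
by move=> h; apply: mon_ideal_min => // e /h; apply: mem_mon_ideal.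
Qed.

Lemma monomD e f : monom (expoD e f) = monom e * monom f.
Proof.
by rewrite /monom -big_split; apply: eq_bigr => i _; rewrite ffunE exprD.
Qed.

Lemma monom1 k : monom (expo1 k) = x k.
Proof.
rewrite /monom (bigD1 k) //= ffunE eqxx expr1 big1 ?mulr1 // => i ik.
by rewrite ffunE (negbTE ik) expr0.
Qed.

Lemma expo_decK k e : (0 < e k)%N -> e = expoD (expo_dec k e) (expo1 k).
Proof.
move=> h; apply/ffunP => i; rewrite !ffunE; case: eqP => [->|_].
  by rewrite subnK.
by rewrite subn0 addn0.
Qed.

Lemma monom_dec k e : (0 < e k)%N -> monom e = x k * monom (expo_dec k e).
Proof. by move=> h; rewrite {1}(expo_decK h) monomD monom1 mulrC. Qed.

Lemma expo_dec_id k e : e k = 0%N -> expo_dec k e = e.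
Proof.
move=> h; apply/ffunP => i; rewrite !ffunE.
by case: eqP => [->|_]; rewrite ?h ?subn0.
Qed.

Lemma expo_subK e f : (forall i, (e i <= f i)%N) ->
  f = expoD [ffun i => (f i - e i)%N] e.
Proof. by move=> h; apply/ffunP => i; rewrite !ffunE subnK. Qed.

Lemma expo_deg_dec k e : expo_deg e = (expo_deg (expo_dec k e) + (0 < e k))%N.
Proof.
rewrite /expo_deg (bigD1 k) //= [in RHS](bigD1 k) //= ffunE eqxx.
rewrite addnAC; congr (_ + _)%N.
  by case: (e k) => // n; rewrite subn1 addn1.
by apply: eq_bigr => i /negbTE ik; rewrite ffunE ik subn0.
Qed.

Lemma expo_deg0 e : expo_deg e = 0%N -> monom e = 1.
Proof.
move=> /eqP; rewrite sum_nat_eq0 => /forallP h.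
by rewrite /monom big1 // => i _; have /eqP -> := h i; rewrite expr0.
Qed.

Lemma expo_deg_gt0 e : (0 < expo_deg e)%N -> exists k, (0 < e k)%N.
Proof.
rewrite lt0n sum_nat_eq0 negb_forall => /existsP[k ek]; exists k.
by rewrite lt0n.
Qed.

Lemma expo_deg1 e : expo_deg e = 1%N -> exists k, e = expo1 k.
Proof.
move=> h1; have [|k hk] := @expo_deg_gt0 e; first by rewrite h1.
exists k; move: h1; rewrite (expo_deg_dec k) hk addn1 => -[/eqP].
rewrite sum_nat_eq0 => /forallP h; rewrite {1}(expo_decK hk).
by apply/ffunP => i; rewrite ffunE; have /eqP -> := h i.
Qed.

Lemma mon_ideal_above L : mon_ideal (expo_above L) = mon_ideal [set` L].
Proof.
rewrite eqEsubset; split; last first.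
  by apply: mon_ideal_sub => a ha; exists a.
apply: mon_ideal_min => // f [a ha /expo_subK ->]; rewrite monomD.
by apply: (idealMl _ (mon_ideal_ideal _)) => //; apply: mem_mon_ideal.
Qed.

Lemma mon_ideal_split U V W k z :
  (forall e, U e -> V e \/ (exists2 f, W f & monom e = x k * monom f)) ->
  mon_ideal U z -> ideal_add_mul (mon_ideal V) (x k) (mon_ideal W) z.
Proof.
move=> h; apply: mon_ideal_min; first exact: ideal_add_mul_ideal.
move=> e /h [hV|[f hf ->]].
  by apply: sub_ideal_add_mul => //; apply: mem_mon_ideal.
by apply: ideal_add_mul_r => //; apply: mem_mon_ideal.
Qed.

(** Passes from sets of exponents to lists, on which one can induct by total degree. *)
Lemma mon_ideal_finite U z :
  mon_ideal U z -> exists2 L : seq expo, [set` L] `<=` U & mon_ideal [set` L] z.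
Proof.
move: z; apply: (ideal_gen_min
  (I := [set z | exists2 L : seq expo, [set` L] `<=` U &
                                       mon_ideal [set` L] z])).
  split=> [|a b [L hL ha] [L' hL' hb]|a b [L hL hb]].
  - by exists [::] => //; apply: ideal0.
  - exists (L ++ L').
      by move=> e /=; rewrite mem_cat => /orP[/hL|/hL'].
    apply: (idealD (mon_ideal_ideal _)) => //.
      by apply: mon_ideal_sub ha => e /= he; rewrite mem_cat he.
    by apply: mon_ideal_sub hb => e /= he; rewrite mem_cat he orbT.
  - by exists L => //; apply: (idealMl _ (mon_ideal_ideal _)).
move=> _ [e he <-]; exists [:: e]; first by move=> f /=; rewrite inE => /eqP ->.
by apply: mem_mon_ideal; rewrite /= mem_head.
Qed.

(** * Variables as nonzerodivisors modulo monomial ideals *)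

(** All that the rest of the section assumes about [x]; [regular_parameters_regular] provides it. *)
Hypothesis param_regular : forall (S : {set 'I_d}) j (r : R), j \notin S ->
  ideal_gen (x @` [set` S]) (r * x j) -> ideal_gen (x @` [set` S]) r.

Definition gens_without k L := [seq a : expo <- L | a k == 0%N].

Lemma gens_without_sub k L :
  mon_ideal [set` gens_without k L] `<=` mon_ideal [set` L].
Proof. by apply: mon_ideal_sub => a /=; rewrite mem_filter => /andP[]. Qed.

Lemma gens_without_dec k L :
  mon_ideal [set` gens_without k L] `<=` mon_ideal [set` map (expo_dec k) L].
Proof.
apply: mon_ideal_sub => a /=; rewrite mem_filter => /andP[/eqP ak aL].
by rewrite -(expo_dec_id ak) map_f.
Qed.

Lemma mon_ideal_dec k L z :
  mon_ideal [set` L] z ->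
  ideal_add_mul (mon_ideal [set` gens_without k L]) (x k)
    (mon_ideal [set` map (expo_dec k) L]) z.
Proof.
apply: mon_ideal_split => a /= aL; have [ak|ak] := posnP (a k).
  by left; rewrite mem_filter ak.
right; exists (expo_dec k a); last exact: monom_dec.
by rewrite /= map_f.
Qed.

Lemma mon_ideal_dec_mul k L r :
  mon_ideal [set` map (expo_dec k) L] r -> mon_ideal [set` L] (r * x k).
Proof.
move: r; apply: mon_ideal_min; first exact: ideal_colon_elt_ideal.
move=> _ /= /mapP[a aL ->]; have [ak|ak] := posnP (a k).
  rewrite expo_dec_id //; apply: (idealMr _ (mon_ideal_ideal _)).
  exact: mem_mon_ideal.
by rewrite mulrC -monom_dec //; apply: mem_mon_ideal.
Qed.

Definition total_deg L := (\sum_(a <- L) expo_deg a)%N.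

Lemma total_deg_dec k L :
  total_deg L = (total_deg (map (expo_dec k) L) + \sum_(a <- L) (0 < a k))%N.
Proof.
rewrite /total_deg big_map -big_split.
by apply: eq_bigr => a _; apply: expo_deg_dec.
Qed.

Lemma total_deg_without k L : total_deg L =
  (total_deg (gens_without k L) + \sum_(a <- L | a k != 0) expo_deg a)%N.
Proof. by rewrite /total_deg (bigID (fun a => a k == 0%N)) /= big_filter. Qed.

Lemma leq_sum_mem (P : pred expo) (F : expo -> nat) L a :
  a \in L -> P a -> (F a <= \sum_(b <- L | P b) F b)%N.
Proof. by move=> aL Pa; rewrite (big_rem a) //= Pa leq_addr. Qed.

Definition var_regular L := forall j r, (forall a, a \in L -> a j = 0%N) ->
  mon_ideal [set` L] (r * x j) -> mon_ideal [set` L] r.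

(** Write [r * x k = u + x k * v] with [u] in the ideal of the generators without [x k]. Then
    [(r - v) * x k = u], and regularity puts [r - v] in that ideal. *)
Lemma mon_ideal_colon_var k L r :
  var_regular (gens_without k L) ->
  mon_ideal [set` L] (r * x k) -> mon_ideal [set` map (expo_dec k) L] r.
Proof.
move=> reg /(mon_ideal_dec k) [u [v [hu hv e]]].
rewrite -[r](subrK v); apply: (idealD (mon_ideal_ideal _)) => //.
apply: gens_without_dec.
apply: (reg k); first by move=> a; rewrite mem_filter => /andP[/eqP].
by have -> : (r - v) * x k = u by rewrite mulrBl e; ring.
Qed.

(** Unless [1] is a generator, the generators are parameters, and [param_regular] applies. *)
Lemma var_regular_linear L :
  (forall a, a \in L -> (expo_deg a <= 1)%N) -> var_regular L.
Proof.
move=> Ldeg j r Lj hr.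
have [[a aL a0]|L0] := pselect (exists2 a, a \in L & expo_deg a = 0%N).
  rewrite -[r]mulr1 -(expo_deg0 a0); apply: (idealMl _ (mon_ideal_ideal _)).
  exact: mem_mon_ideal.
pose S : {set 'I_d} := finset (fun k => expo1 k \in L).
suff eS : mon_ideal [set` L] = ideal_gen (x @` [set` S]).
  rewrite eS in hr *; apply: param_regular hr.
  by rewrite inE; apply/negP => /Lj; rewrite ffunE eqxx.
rewrite eqEsubset; split.
  apply: mon_ideal_min; first exact: ideal_gen_ideal.
  move=> a aL; have [|k ek] := @expo_deg1 a.
    have := Ldeg a aL; case E: (expo_deg a) => [|[|n]] // _.
    by case: L0; exists a.
  rewrite ek monom1; apply: sub_ideal_gen; exists k => //=.
  by rewrite inE -ek.
apply: ideal_gen_min; first exact: mon_ideal_ideal.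
move=> _ [k /= kL <-]; rewrite inE in kL.
by rewrite -monom1; apply: mem_mon_ideal.
Qed.

(* Induction on the total degree of the generators: pick a variable [x k] of a
   generator of degree at least 2, and let [L0] be the generators without it.
   The lists [L0], [x k :: L0] and [L : x k] all have a smaller total degree. *)
Lemma var_regularP L : var_regular L.
Proof.
have [n] := ubnP (total_deg L); elim: n L => // n IH L; rewrite ltnS => Ln.
have [h|] := boolP (all (fun a => expo_deg a <= 1)%N L).
  by apply: var_regular_linear => a aL; apply: (allP h).
move=> /allPn[a aL]; rewrite -ltnNge => a2.
have [k] := expo_deg_gt0 (ltnW a2); rewrite lt0n => ak.
(* Dropping the generators divisible by [x k] loses degree at least 2, which leaves room for [x k]
   itself. *)
have h2 := leq_trans a2 (leq_sum_mem expo_deg aL (P := fun b => b k != 0%N) ak).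
have deg0 := total_deg_without k L.
have reg0 : var_regular (gens_without k L).
  apply: IH; apply: leq_trans Ln; rewrite deg0 -addn1 leq_add2l.
  exact: ltnW.
have regD : var_regular (map (expo_dec k) L).
  apply: IH; apply: leq_trans Ln; rewrite (total_deg_dec k L) -addn1 leq_add2l.
  have := @leq_sum_mem predT (fun b => (0 < b k)%N : nat) L a aL isT.
  by rewrite lt0n ak.
have regk : var_regular (expo1 k :: gens_without k L).
  apply: IH; apply: leq_trans Ln; rewrite deg0.
  rewrite /total_deg big_cons addnC -addnS leq_add2l.
  apply: leq_trans h2; rewrite ltnS /expo_deg (bigD1 k) //= ffunE eqxx.
  by rewrite big1 // => i /negbTE ik; rewrite ffunE ik.
move=> j r Lj hr.
have jk : j != k.
  by apply: contraNneq ak => <-; apply/eqP/Lj.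
(* First [r] is found modulo [x k], in an ideal that contains the one of [L]. *)
have : mon_ideal [set` expo1 k :: gens_without k L] r.
  apply: (regk j).
    move=> b; rewrite inE => /orP[/eqP->|]; first by rewrite ffunE (negbTE jk).
    by rewrite mem_filter => /andP[_ /Lj].
  have [u [v [hu _ ->]]] := mon_ideal_dec k hr.
  apply: (idealD (mon_ideal_ideal _)) => //.
    by apply: mon_ideal_sub hu => b /= hb; rewrite inE hb orbT.
  apply: (idealMr _ (mon_ideal_ideal _)).
  rewrite -monom1; apply: mem_mon_ideal.
  by rewrite /= mem_head.
move=> /(mon_ideal_split (V := [set` gens_without k L])
                         (W := setT) (k := k)) [].
  move=> b /=; rewrite inE => /orP[/eqP->|]; last by left.
  right; exists (expo_dec k (expo1 k)) => //; apply: monom_dec.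
  by rewrite ffunE eqxx.
move=> u [v [hu _ er]].
have huL := gens_without_sub hu.
(* It remains to treat [x k * v]: since [v * x j] is in the colon by [x k], where [x j] is regular,
   so is [v]. *)
rewrite er; apply: (idealD (mon_ideal_ideal _)) => //.
rewrite mulrC; apply: mon_ideal_dec_mul.
apply: (regD j).
  by move=> _ /mapP[b bL ->]; rewrite ffunE (Lj b bL).
apply: mon_ideal_colon_var => //.
have -> : v * x j * x k = r * x j - u * x j by rewrite er; ring.
apply: (idealB (mon_ideal_ideal _)) => //.
exact: (idealMr _ (mon_ideal_ideal _)).
Qed.

(** * Colons and intersections of monomial ideals *)

(** The colon by a monomial is taken one variable at a time, by induction on its degree. *)
Lemma mon_ideal_colon e L r :
  mon_ideal [set` L] (r * monom e) ->
  mon_ideal [set f | expo_above L (expoD f e)] r.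
Proof.
have [n] := ubnP (expo_deg e); elim: n e L r => // n IH e L r.
rewrite ltnS => en hr; have [e0|e0] := posnP (expo_deg e).
  move: hr; rewrite expo_deg0 // mulr1 -mon_ideal_above.
  apply: mon_ideal_sub => f [a aL haf]; exists a => // i.
  by rewrite ffunE; apply: leq_trans (haf i) (leq_addr _ _).
have [k ek] := expo_deg_gt0 e0.
have {}hr : mon_ideal [set` L] (r * monom (expo_dec k e) * x k).
  by rewrite -mulrA [_ * x k]mulrC -monom_dec.
have hk := mon_ideal_colon_var (@var_regularP _) hr.
have ekn : (expo_deg (expo_dec k e) < n)%N.
  by move: en; rewrite (expo_deg_dec k) ek addn1.
apply: mon_ideal_sub (IH _ _ _ ekn hk) => f [_ /mapP[a aL ->] haf].
exists a => // i.
have := haf i; rewrite !ffunE; case: eqP => [->|_]; last by rewrite !subn0.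
by rewrite leq_subLR addnCA subnKC.
Qed.

(* Removing [a] from [L1]: [u = w + a r] with [w] in the smaller ideal, and then
   [r] is in the colon by [a] of the ideal generated by [L1 ++ L], so that [a r]
   is in the smaller ideal as well. *)
Lemma mon_ideal_step U L L1 u :
  expo_upset U -> [set` L1] `<=` U ->
  mon_ideal (U `&` expo_above (L1 ++ L)) u -> mon_ideal [set` L] u ->
  mon_ideal (U `&` expo_above L) u.
Proof.
move=> upU; elim: L1 => // a L1 IH sub hu huL.
have Ua : U a by apply: sub; rewrite /= mem_head.
have huL1 : mon_ideal [set` L1 ++ L] u.
  by apply: mon_ideal_sub huL => b /= bL; rewrite mem_cat bL orbT.
apply: IH => //.
  by move=> b bL; apply: sub; rewrite /= inE; apply/orP; right.
have [w [r [hw _ eu]]] :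
    ideal_add_mul (mon_ideal (U `&` expo_above (L1 ++ L))) (monom a) setT u.
  move: hu; apply: mon_ideal_min; first exact: ideal_add_mul_ideal.
  move=> f [Uf [b /=]]; rewrite inE => /orP[/eqP->|bL] bf.
    rewrite (expo_subK bf) monomD mulrC; exact: ideal_add_mul_r.
  by apply: sub_ideal_add_mul => //; apply: mem_mon_ideal; split=> //; exists b.
rewrite eu; apply: (idealD (mon_ideal_ideal _)) => //.
have : mon_ideal [set` L1 ++ L] (r * monom a).
  have -> : r * monom a = u - w by rewrite eu; ring.
  apply: (idealB (mon_ideal_ideal _)) => //; rewrite -mon_ideal_above.
  by apply: mon_ideal_sub hw => f [].
move=> /mon_ideal_colon; rewrite mulrC; move: (r).
apply: mon_ideal_min; first exact: ideal_colon_elt_ideal.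
move=> f hf; rewrite /= -monomD; apply: mem_mon_ideal; split=> //.
by apply: upU Ua _ => i; rewrite ffunE leq_addl.
Qed.

(** Finitely many exponents [L1] of [U] suffice for [u]; they lie above [L1 ++ L], and
    [mon_ideal_step] then removes them. *)
Lemma mon_ideal_setI U L u :
  expo_upset U -> mon_ideal U u -> mon_ideal [set` L] u ->
  mon_ideal (U `&` expo_above L) u.
Proof.
move=> upU /mon_ideal_finite[L1 sub hu] huL.
apply: (mon_ideal_step (L1 := L1)) => //.
apply: mon_ideal_sub hu => a aL; split; first exact: sub.
by exists a; rewrite // mem_cat aL.
Qed.

(** The colon by all variables is the intersection of the colons by each, formed one variable at a
    time. *)
Lemma mon_ideal_colon_vars U u :
  expo_upset U -> (forall j, mon_ideal U (u * x j)) ->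
  mon_ideal [set f | forall j, U (expoD f (expo1 j))] u.
Proof.
move=> upU hu.
suff H (js : seq 'I_d) :
    mon_ideal [set f | forall j, j \in js -> U (expoD f (expo1 j))] u.
  have := H (enum 'I_d); apply: mon_ideal_sub => f hf j.
  by apply: hf; rewrite mem_enum.
elim: js => [|j js IH].
  (* The empty list imposes no condition, so the zero exponent is allowed and the ideal contains
     [1]. *)
  rewrite -[u]mulr1 -(@expo_deg0 [ffun => 0%N]).
    by apply: (idealMl _ (mon_ideal_ideal _)) => //; apply: mem_mon_ideal.
  by rewrite /expo_deg big1 // => i _; rewrite ffunE.
have [L LU huL] := mon_ideal_finite (hu j).
have huD := mon_ideal_colon_var (@var_regularP _) huL.
apply: mon_ideal_sub (mon_ideal_setI _ IH huD) => [f|e f he ef k kjs].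
  move=> [hf [_ /mapP[a aL ->] haf]] k.
  rewrite inE => /orP[/eqP->|]; last exact: hf.
  apply: upU (LU a aL) _ => i; have := haf i; rewrite !ffunE.
  by rewrite leq_subLR addnC.
by apply: upU (he k kjs) _ => i; rewrite !ffunE leq_add2r.
Qed.

End MonomialIdeals.

(** * The criterion for Burch ideals *)

(** List the parameters with those of [S] first, then [x j], then the others, and apply
    [regular_parameter]. *)
Lemma regular_parameters_regular (R : comNzRingType) (m : set R) (d : nat)
    (x : 'I_d -> R) :
  is_regular_local m d -> is_regular_system_of_parameters m x ->
  forall (S : {set 'I_d}) (j : 'I_d) (r : R), j \notin S ->
  ideal_gen (x @` [set` S]) (r * x j) -> ideal_gen (x @` [set` S]) r.
Proof.
move=> [noethR locR dimR _] hx S j r jS.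
have eS : x @` [set` S] = [set` map x (enum S)].
  rewrite eqEsubset; split=> y /=.
    by move=> [i iS <-]; rewrite map_f // mem_enum.
  by move=> /mapP[i]; rewrite mem_enum => iS ->; exists i.
rewrite eS; apply: (regular_parameter noethR locR dimR
  (s2 := map x (enum (~: (j |: S))))) => //.
  rewrite hx -map_cons -map_cat; congr ideal_gen.
  rewrite eqEsubset; split=> y /=; last by move=> /mapP[i _ ->]; exists i.
  move=> [i _ <-]; rewrite map_f // mem_cat inE !mem_enum !inE.
  by case: (i \in S); case: (i == j).
rewrite size_cat /= !size_map -!cardE cardsCs finset.setCK cardsU1 jS add1n.
rewrite card_ord addnS -addSn subnKC //.
by have := max_card (mem (j |: S)%SET); rewrite cardsU1 jS card_ord.
Qed.

(* In the conclusion v is the quotient w / x_i (unique, R being a domain), so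
   that v * x j is w (x_j / x_i). *)
Theorem proposition6p4 (R : comNzRingType) (m : set R) (d : nat)
    (hR : is_regular_local m d)
    (x : 'I_d -> R) (hx : is_regular_system_of_parameters m x)
    (I : set R) (hI : is_monomial_ideal x I) :
  is_Burch m I <->
  exists (w : R) (i : 'I_d),
    [/\ is_monomial x w, I w, ~ ideal_mul m I w &
        exists2 v : R, w = x i * v & forall j : 'I_d, I (v * x j)].
Proof.
have reg := regular_parameters_regular hR hx.
have [A monA eI] := hI.
have hIi : is_ideal I by rewrite eI; apply: ideal_gen_ideal.
have hmm : is_ideal (ideal_mul m I) by apply: ideal_gen_ideal.
split; last first.
  move=> [w [i [_ _ nw [v ew hv]]]] e; apply: nw; rewrite e ew.
  apply: sub_ideal_gen; exists (x i).
    by rewrite hx; apply: sub_ideal_gen; exists i.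
  exists v => //.
  move=> b; rewrite mulrC hx; move: b.
  have /ideal_gen_min := ideal_colon_elt_ideal v hIi; apply.
  by move=> _ [j _ <-]; rewrite /= mulrC.
move=> burch; apply: contrapT => nw; apply: burch.
rewrite eqEsubset; split.
  apply: ideal_gen_sub => _ [a ha [b hb <-]]; exists a => //; exists b => //.
  by move=> c _; apply: idealMr.
pose U : set {ffun 'I_d -> nat} := [set e | I (monom x e)].
have upU : expo_upset U.
  by move=> e f he /expo_subK ->; rewrite /U /= monomD; apply: idealMl.
have IU : I `<=` mon_ideal x U.
  rewrite {1}eI; apply: ideal_gen_min; first exact: mon_ideal_ideal.
  move=> a aA; have [e ea] := monA a aA.
  have {}ea : a = monom x [ffun i => e i].
    by rewrite ea; apply: eq_bigr => i _; rewrite ffunE.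
  rewrite ea; apply: mem_mon_ideal; rewrite /U /= -ea eI.
  exact: sub_ideal_gen.
apply: ideal_gen_min => // _ [a ma [b hb <-]].
have : mon_ideal x [set f | forall j, U (expoD f (expo1 j))] b.
  apply: (mon_ideal_colon_vars reg upU) => j.
  by apply: IU; apply: hb; rewrite hx; apply: sub_ideal_gen; exists j.
move: b {hb}.
(* The colon is generated by monomials and [m] by the [x i], so only the products [x i * monom x e]
   need to be checked. *)
suff H e : (forall j, U (expoD e (expo1 j))) -> ideal_mul m I (a * monom x e).
  move=> b; rewrite mulrC; move: b.
  apply: mon_ideal_min; first exact: ideal_colon_elt_ideal.
  by move=> e /H; rewrite /= mulrC.
move=> he; move: a ma; rewrite {1}hx.
have /ideal_gen_min := ideal_colon_elt_ideal (monom x e) hmm; apply.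
(* A product outside [m I] would be the excluded [w], with [v] equal to [monom x e]. *)
move=> _ [i _ <-]; apply: contrapT => nmI; apply: nw.
have ew : monom x (expoD e (expo1 i)) = x i * monom x e.
  by rewrite monomD monom1 mulrC.
exists (x i * monom x e), i; split=> //.
- by exists (expoD e (expo1 i)).
- by rewrite -ew; apply: he.
- exists (monom x e) => // j.
  by have := he j; rewrite /U /= monomD monom1.
Qed.
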